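(* Let $p$ be a prime with $p\equiv1\pmod4$ and let $(y(n))_{n\ge0}$ be an integer sequence with $y(0)=1$ and with the property that, for every positive integer $h$, $v_p(y(n))\ge h$ for all $n\ge\left\lceil\frac{hp}{2}\right\rceil$. For all positive integers $n$, $k$, and $e$ with $n\ge e+1$, we have $$p^{\lfloor 2k/p\rfloor}R_y^{-1}\bigl(2n+p^{e-1}(p-1),2k\bigr)\equiv y\bigl(\tfrac{p-1}{2}\bigr)^{p^{e-1}}\cdot(-1)^{(p-5)/4}\,p^{\lfloor 2k/p\rfloor}R_y^{-1}(2n,2k)\pmod{p^e}.$$ In particular, if $y\bigl(\frac{p-1}{2}\bigr)$ is a quadratic residue modulo $p$ and coprime to $p$, then the sequence $\bigl(p^{\lfloor 2k/p\rfloor}R_y^{-1}(2n,2k)\bigr)_{n\ge e+1}$, when taken modulo any fixed $p$-power $p^e$ with $e\ge1$, is purely periodic with (not necessarily minimal) period length $\frac14p^{e-1}(p-1)^2$.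
   Context: $v_p$ denotes the $p$-adic valuation (with $v_p(0)=\infty$). For an integer sequence $(y(j))_{j\ge0}$ with $y(0)=1$, set $U_y(t)=\sum_{j\ge0}\frac{y(j)}{(2j+1)!}t^{2j+1}$ and $$R_y^{-1}(n,k)=2^{(n-k)/2}\frac{(n-1)!}{(k-1)!}\langle t^{-k}\rangle U_y^{-n}(t),$$ where $\langle t^N\rangle F(t)$ denotes the coefficient of $t^N$ in the formal Laurent series $F(t)$, and where $R_y^{-1}(0,0)=1$ and $R_y^{-1}(n,0)=0$ for $n\ge1$. The numbers $R_y^{-1}(2n,2k)$ are integers. A sequence $(a(n))_{n\ge N}$ is purely periodic modulo $M$ with (not necessarily minimal) period length $L$ if $a(n+L)\equiv a(n)\pmod M$ for all $n\ge N$. *)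

(* Defs.v *)
From HB Require Import structures.
From mathcomp Require Import all_boot all_order all_algebra.
Set Implicit Arguments.
Unset Strict Implicit.
Unset Printing Implicit Defensive.
Import Order.TTheory GRing.Theory Num.Theory.
Local Open Scope ring_scope.

(* [Laurent v c] stands for the formal Laurent series
   \sum_(i >= 0) c i * t^(v + i).  The coefficient [c 0] may vanish, so [v] is
   only a lower bound for the order, and distinct representations may denote
   the same series: compare series through [laurent_coef]. *)
Record laurent (F : fieldType) := Laurent {
  lshift_exp : int;
  lcoef : nat -> F
}.

Section Laurent.
Variable F : fieldType.
Implicit Types (f g : laurent F) (c : nat -> F).

(* The coefficient of t^N. *)
Definition laurent_coef f (N : int) : F :=
  if lshift_exp f <= N then lcoef f `|N - lshift_exp f|%N else 0.

Definition laurent_one : laurent F := Laurent 0 (fun i => (i == 0%N)%:R).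

Definition laurent_mul f g : laurent F :=
  Laurent (lshift_exp f + lshift_exp g)
    (fun m => \sum_(i < m.+1) lcoef f i * lcoef g (m - i)%N).

(* The first n coefficients of the inverse of the power series with
   coefficients c, obtained by solving (c * b)_m = (m == 0) for b_m. *)
Fixpoint ps_inv_seq c (n : nat) : seq F :=
  if n is m.+1 then
    let s := ps_inv_seq c m in
    rcons s ((c 0%N)^-1 * ((m == 0%N)%:R - \sum_(i < m) c (m - i)%N * s`_i))
  else [::].

(* Meaningful only when [lcoef f 0 != 0]; see [laurent_mulfV]. *)
Definition laurent_inv f : laurent F :=
  Laurent (- lshift_exp f) (fun m => (ps_inv_seq (lcoef f) m.+1)`_m).

Definition laurent_exp f (n : nat) : laurent F :=
  iter n (laurent_mul f) laurent_one.

Lemma size_ps_inv_seq c n : size (ps_inv_seq c n) = n.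
Proof. by elim: n => //= n IHn; rewrite size_rcons IHn. Qed.

Lemma nth_ps_inv_seq c n i : (i < n)%N ->
  (ps_inv_seq c n)`_i = (ps_inv_seq c i.+1)`_i.
Proof.
elim: n => // n IHn; rewrite ltnS leq_eqVlt => /predU1P[-> //|lt_in].
by rewrite [in LHS]/= nth_rcons size_ps_inv_seq lt_in IHn.
Qed.

Lemma laurent_mulfV f (N : int) : lcoef f 0 != 0 ->
  laurent_coef (laurent_mul f (laurent_inv f)) N = laurent_coef laurent_one N.
Proof.
move=> f0; rewrite /laurent_coef /= subrr; case: ifP => // _.
move: `|N - 0|%N => m; rewrite big_ord_recl /= subn0.
rewrite nth_rcons size_ps_inv_seq ltnn eqxx mulrA mulfV // mul1r.
rewrite -[RHS]addr0 -addrA; congr (_ + _); apply/eqP; rewrite addrC subr_eq0.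
rewrite (reindex_inj rev_ord_inj) /=; apply/eqP/eq_bigr => i _.
have lt_im := ltn_ord i.
rewrite /bump /= add1n subnSK // subKn; last exact: ltnW.
by rewrite (nth_ps_inv_seq _ lt_im).
Qed.

End Laurent.

(* The coefficient of t^m in U_y(t) = \sum_j y(j) / (2j+1)! * t^(2j+1). *)
Definition U_coef (y : nat -> int) (m : nat) : rat :=
  if odd m then (y m./2)%:~R / (m`!)%:R else 0.

(* The constant coefficient vanishes, so the series is stored from t^1 on; its
   leading coefficient is then y 0 = 1. *)
Definition U_series (y : nat -> int) : laurent rat :=
  Laurent 1 (fun i => U_coef y i.+1).

(* R_y^{-1}(n,k).  When n - k is odd the (floored) exponent of 2 is irrelevant,
   since the Laurent coefficient is then 0.  The value 0 for n = 0 < k is a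
   convention. *)
Definition Rinv (y : nat -> int) (n k : nat) : rat :=
  match k, n with
  | 0%N, _ => (n == 0%N)%:R
  | _, 0%N => 0
  | k'.+1, n'.+1 =>
      2 ^ ((n%:Z - k%:Z) %/ 2)%Z * ((n'`!)%:R / (k'`!)%:R)
      * laurent_coef (laurent_exp (laurent_inv (U_series y)) n) (- k%:Z)
  end.

(* v_p(z) >= h, with v_p(0) = oo whereas [logn p 0 = 0]. *)
Definition valuation_ge (p : nat) (z : int) (h : nat) : bool :=
  (z == 0) || (h <= logn p `|z|)%N.

(* Congruence of integers given as rational numbers: a - b \in M Z. *)
Definition rat_eqmod (M : nat) (a b : rat) : Prop :=
  exists z : int, a - b = M%:R * z%:~R.

Definition quadratic_residue (p : nat) (a : int) : Prop :=
  exists x : int, (x ^+ 2 = a %[mod p%:Z])%Z.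

(* The sequence (a n)_(n >= N) is purely periodic modulo M with (not
   necessarily minimal) period length L. *)
Definition purely_periodic_mod (N M L : nat) (a : nat -> rat) : Prop :=
  forall n : nat, (N <= n)%N -> rat_eqmod M (a (n + L)%N) (a n).

(* Main.v *)
Require Import Defs.
From mathcomp Require Import all_boot all_order all_algebra.
From mathcomp Require Import finfield zify ring.
Import Order.TTheory GRing.Theory Num.Theory.
Local Open Scope ring_scope.

(** Write h = (p - 1) / 2 and q = p ^ (e - 1).  Split U_y(t) as
    t + y(h) t^p / p! + G(t) and expand the N-th power of its inverse by the
    negative binomial theorem.  If s and r are the exponents of the second and
    of the third summand, then R_y^{-1}(N, K) becomes ([Rinv_sum]) a power of 2
    times the sum over s and r of the terms
      (-1)^(s+r) y(h)^s W(s) C(A + s p, s p) C(A, K - 1) B(A - (K - 1), r),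
    where A = N - 1 + s + r - s p, where W(s) = (s p)! / (s! p!^s) is an integer,
    and where B(b, r) = b! / r! times the coefficient of t^b in G^r.

    The point of this form is that A does not change when N is replaced by
    N + q (p - 1) and s by s + q.  So the terms of the two sums can be compared
    one by one ([Rterm_shift]).  The sign and the power of y(h) give the factor
    - y(h)^q.  The factor W is periodic modulo p^e, by a form of Wilson's
    theorem for p^e ([blocks_shift]).  The binomial C(A + s p, A) becomes
    C(A + s p + p^e, A), and the two differ by a number that need not be
    divisible by p^e but becomes so after multiplication by
    p^(floor (log_p A)) ([bin_shift_ppow]).  The terms with s < q of the longer
    sum have no partner, and have to be divisible by p^e ([Rterm_low]).

    Both gaps are filled by the remaining factors: p^(floor (K / p)) C(A, K - 1)
    B(A - (K - 1), r) is divisible by p to the power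
      weight(A) = max (floor (log_p A), ceil (floor (A / p) / 2))
    ([rest_term_weighted]).  The logarithm pays for the loss in the binomials;
    the linear part disposes of the terms with A + s p < p^e, for which A is
    large.  The function weight is chosen such that
      weight(a + b) <= v_p(C(a + b, a)) + weight(a) + weight(b),
    so that the exponential generating functions whose b-th coefficient is
    divisible by p^(weight(b)) are closed under products ([weightedM]).  The
    bound on B therefore has to be checked only for the divided powers of a
    single monomial y(j) t^m / m!, m = 2j + 1.  If m < p, it holds because the
    number of partitions of a set into i blocks of size m is divisible by a high
    power of p; if m > p, because of the hypothesis on the valuation of y(j).
    Only m = p fails, which is why this monomial is kept apart.

    The power of 2 contributes 2^(q (p - 1) / 2), which is congruent to
    (-1)^((p - 1) / 4) by the quadratic character of 2 ([two_pow_half]).  Finally,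
    (p - 1) / 2 iterations of the congruence multiply the sequence by
    y(h)^(q (p - 1) / 2), which is 1 modulo p^e when y(h) is a square prime to
    p; this gives the period. *)

(** * Valuations of binomial coefficients and the weight function *)

Lemma logn_fact_widen (p n L : nat) : prime p -> (n < L)%N ->
  logn p n`! = (\sum_(1 <= i < L) n %/ p ^ i)%N.
Proof.
move=> p_pr ltnL; rewrite logn_fact // [RHS](big_cat_nat (n := n.+1)) //=.
rewrite [X in (_ + X)%N]big_nat_cond [X in (_ + X)%N]big1 ?addn0 // => i /andP[/andP[lti _] _].
by rewrite divn_small // (leq_trans (ltn_expl n (prime_gt1 p_pr))) // leq_exp2l ?prime_gt1 // ltnW.
Qed.

(** Written as a sum over the powers of p, the logarithm can be compared term by
    term with Legendre's formula. *)
Lemma trunc_log_sum (p n L : nat) : (1 < p)%N -> (n < L)%N ->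
  trunc_log p n = (\sum_(1 <= i < L) (p ^ i <= n))%N.
Proof.
move=> p1 ltnL; case: n ltnL => [|n] ltnL.
  rewrite trunc_log0 big_nat_cond big1 // => i _.
  by rewrite leqn0 expn_eq0 -leqn0 leqNgt ltnW.
have /andP[le_tn lt_nt] := trunc_log_bounds p1 (ltn0Sn n).
set t := trunc_log p n.+1 in le_tn lt_nt *.
have lt_tL : (t < L)%N.
  by rewrite (leq_trans _ ltnL) // ltnS (leq_trans _ le_tn) // ltnW // ltn_expl.
rewrite (big_cat_nat (n := t.+1)) //=.
rewrite [X in (X + _)%N]big_nat_cond [X in (_ + X)%N]big_nat_cond.
rewrite [X in (X + _)%N](eq_bigr (fun _ => 1%N)); last first.
  move=> i; rewrite andbT ltnS => /andP[_ le_it].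
  by rewrite (leq_trans _ le_tn) ?leq_exp2l.
rewrite [X in (_ + X)%N]big1 ?addn0; last first.
  move=> i; rewrite andbT => /andP[le_ti _]; rewrite leqNgt (leq_trans lt_nt) //.
  by rewrite leq_exp2l.
by rewrite -big_nat_cond sum_nat_const_nat muln1 subn1.
Qed.

Lemma logn_bin_sum (p a b L : nat) : prime p -> (a + b < L)%N ->
  (logn p 'C(a + b, a) + (\sum_(1 <= i < L) a %/ p ^ i + \sum_(1 <= i < L) b %/ p ^ i)
   = \sum_(1 <= i < L) (a + b) %/ p ^ i)%N.
Proof.
move=> p_pr ltL; have ltaL := leq_ltn_trans (leq_addr b a) ltL.
have ltbL := leq_ltn_trans (leq_addl a b) ltL.
rewrite -!logn_fact_widen // -(bin_fact (leq_addr b a)) addKn.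
by rewrite !lognM ?muln_gt0 ?fact_gt0 ?bin_gt0 ?leq_addr.
Qed.

Lemma trunc_logD_bin (p a b : nat) : prime p ->
  (trunc_log p (a + b) <= logn p 'C(a + b, a) + (trunc_log p a + trunc_log p b))%N.
Proof.
move=> p_pr; have p1 := prime_gt1 p_pr; set L := (a + b).+1.
have ltL : (a + b < L)%N by [].
have ltaL := leq_ltn_trans (leq_addr b a) ltL.
have ltbL := leq_ltn_trans (leq_addl a b) ltL.
rewrite !(trunc_log_sum _ _ L) //.
suff: (\sum_(1 <= i < L) ((p ^ i <= a + b) + (a %/ p ^ i + b %/ p ^ i))
  <= \sum_(1 <= i < L) ((a + b) %/ p ^ i + ((p ^ i <= a) + (p ^ i <= b))))%N.
  by rewrite !big_split /= -logn_bin_sum //; lia.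
apply: leq_sum => i _; set P := (p ^ i)%N.
have P0 : (0 < P)%N by rewrite expn_gt0 prime_gt0.
have leD : (a %/ P + b %/ P <= (a + b) %/ P)%N by rewrite divnD // leq_addr.
have [lePa|ltaP] := leqP P a; have [lePb|ltbP] := leqP P b;
  try by move: leD; case: (P <= a + b)%N; lia.
(* Neither a nor b reaches P, so if a + b does, the quotient of a + b grows. *)
rewrite (divn_small ltaP) (divn_small ltbP); have := divn_gt0 (a + b) P0.
by case: (P <= a + b)%N; case: ((a + b) %/ P)%N.
Qed.

(** The number of partitions of a set of i * m elements into i blocks of size m:
    each factor chooses the companions of the least element not yet used. *)
Definition blocks (m i : nat) : nat := (\prod_(j < i) 'C(j.+1 * m - 1, m - 1))%N.

Lemma blocks_fact m i : (0 < m)%N ->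
  (blocks m i * (i`! * m`! ^ i) = (i * m)`!)%N.
Proof.
move=> m0; elim: i => [|i IHi]; first by rewrite /blocks big_ord0.
have le_m : (m <= i.+1 * m)%N by rewrite leq_pmull.
have Ebin : ('C(i.+1 * m, m) = i.+1 * 'C(i.+1 * m - 1, m - 1))%N.
  apply/eqP; rewrite -(eqn_pmul2l m0); apply/eqP.
  have := mul_bin_diag (i.+1 * m) m.-1; rewrite prednK // -!subn1 => <-.
  by rewrite -mulnA mulnCA.
have Esub : (i.+1 * m - m = i * m)%N by rewrite mulSn addKn.
rewrite -(bin_fact le_m) Esub Ebin -IHi /blocks big_ord_recr /= factS expnS.
set u := 'C(_, _); set v := (\prod_(_ < _) _)%N; set f := (i`!); set e := (m`! ^ i)%N.
by ring.
Qed.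

Lemma blocks_gt0 m i : (0 < m)%N -> (0 < blocks m i)%N.
Proof.
move=> m0; have := fact_gt0 (i * m); rewrite -blocks_fact // muln_gt0.
by case/andP.
Qed.

Lemma logn_fact_lt (p m : nat) : prime p -> (m < p)%N -> logn p m`! = 0%N.
Proof.
move=> p_pr ltmp; rewrite logn_fact // big_nat_cond big1 // => i /andP[/andP[i1 _] _].
by rewrite divn_small // (leq_trans ltmp) // -[X in (X <= _)%N]expn1 leq_exp2l ?prime_gt1.
Qed.

(** The logarithm compensates what is lost when p ^ e is added to the upper index
    of a binomial coefficient; the linear part, roughly a / (2 p), makes terms
    with a large divisible by any prescribed power of p. *)
Definition weight (p a : nat) : nat := maxn (trunc_log p a) (uphalf (a %/ p)).

Lemma weight0 p : weight p 0 = 0%N.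
Proof. by rewrite /weight trunc_log0 div0n. Qed.

(** Each part of the weight is subadditive up to the number of carries in the
    addition of a and b: a new power of p below a + b requires a carry, and so
    does an increase of the quotient by p. *)
Lemma weightD_bin p a b : prime p ->
  (weight p (a + b) <= logn p 'C(a + b, a) + (weight p a + weight p b))%N.
Proof.
move=> p_pr; rewrite {1}/weight geq_max; apply/andP; split.
  by have := trunc_logD_bin p a b p_pr; rewrite /weight; lia.
suff: ((a + b) %/ p <= logn p 'C(a + b, a) + (a %/ p + b %/ p))%N.
  by rewrite /weight; lia.
have := logn_bin_sum p a b (a + b).+2 p_pr (leqnSn _).
rewrite ![(\sum_(1 <= _ < _.+2) _)%N]big_nat_recl // expn1.
suff: (\sum_(1 <= i < (a + b).+1) a %/ p ^ i.+1 +
   \sum_(1 <= i < (a + b).+1) b %/ p ^ i.+1 <=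
  \sum_(1 <= i < (a + b).+1) (a + b) %/ p ^ i.+1)%N by lia.
rewrite -big_split /=; apply: leq_sum => i _.
by rewrite divnD ?leq_addr // expn_gt0 prime_gt0.
Qed.

Lemma ltn_mul2_exp (p x : nat) : (2 < p)%N -> (0 < x)%N -> (2 * x < p ^ x)%N.
Proof.
move=> p2; elim: x => // x IH _; rewrite expnS.
case: x IH => [|x] IH; first by rewrite expn0 !muln1.
by move: (p ^ x.+1)%N (IH isT) => P; nia.
Qed.

Lemma weight_le (p a x : nat) : (2 < p)%N -> (a < x.+1 * p)%N -> (weight p a <= x)%N.
Proof.
move=> p2 lta; rewrite /weight geq_max; apply/andP; split.
  have p1 : (1 < p)%N by lia.
  rewrite leqNgt; apply/negP => ltx.
  have a0 : (0 < a)%N by case: (a) ltx => //; rewrite trunc_log0.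
  have := trunc_logP p1 a0; apply/negP; rewrite -ltnNge (leq_trans lta) //.
  rewrite (@leq_trans (p ^ x.+1)) ?leq_exp2l // expnSr leq_mul2r ltn_expl //.
  by rewrite orbT.
have : (a %/ p < x.+1)%N by rewrite ltn_divLR //; lia.
by move: (a %/ p)%N => d; lia.
Qed.

Lemma weight_leq_double (p a x : nat) : (2 < p)%N -> (0 < x)%N -> (a <= 2 * x * p)%N ->
  (weight p a <= x)%N.
Proof.
move=> p2 x0 lea; rewrite /weight geq_max; apply/andP; split.
  have p1 : (1 < p)%N by lia.
  rewrite leqNgt; apply/negP => ltx.
  have a0 : (0 < a)%N by case: (a) ltx => //; rewrite trunc_log0.
  have := trunc_logP p1 a0; apply/negP; rewrite -ltnNge (leq_ltn_trans lea) //.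
  rewrite (@leq_trans (p ^ x.+1)) ?leq_exp2l // expnSr ltn_mul2r ltn_mul2_exp //.
  by rewrite andbT; lia.
have : (a %/ p < (2 * x).+1)%N by rewrite ltn_divLR; nia.
by move: (a %/ p)%N => d; lia.
Qed.

(** Since p does not divide m!, the valuation of the number of partitions is that
    of (i m)! / i!.  Every power of p up to i m contributes at least one to it,
    because m > 1, and p itself contributes at least half of the quotient. *)
Lemma weight_small_blocks (p m i : nat) : prime p -> (1 < m < p)%N ->
  (weight p (i * m) <= logn p (blocks m i))%N.
Proof.
move=> p_pr /andP[m1 ltmp]; have m0 := ltnW m1; have p1 := prime_gt1 p_pr.
have ltL : (i * m < (i * m).+2)%N by [].
have ltiL : (i < (i * m).+2)%N by rewrite ltnS (leq_trans (leq_pmulr i m0)).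
have double_div P : (0 < P)%N -> (2 * (i %/ P) <= (i * m) %/ P)%N.
  move=> P0; rewrite leq_divRL // -mulnA mulnC leq_mul //.
  by rewrite leq_trunc_div.
have Esum : (logn p (blocks m i) + \sum_(1 <= j < (i * m).+2) i %/ p ^ j
             = \sum_(1 <= j < (i * m).+2) (i * m) %/ p ^ j)%N.
  rewrite -!logn_fact_widen // -(blocks_fact m i m0) !lognM ?lognX.
  - by rewrite (logn_fact_lt p m) // muln0 addn0.
  - exact: fact_gt0.
  - by rewrite expn_gt0 fact_gt0.
  - exact: blocks_gt0.
  - by rewrite muln_gt0 expn_gt0 !fact_gt0.
rewrite /weight geq_max; apply/andP; split.
  rewrite (trunc_log_sum _ _ _ p1 ltL).
  suff: (\sum_(1 <= j < (i * m).+2) ((p ^ j <= i * m) + i %/ p ^ j)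
    <= \sum_(1 <= j < (i * m).+2) (i * m) %/ p ^ j)%N.
    by rewrite big_split /=; lia.
  apply: leq_sum => j _; set P := (p ^ j)%N.
  have P0 : (0 < P)%N by rewrite expn_gt0 prime_gt0.
  have := double_div P P0; have := divn_gt0 (i * m) P0.
  have [lePi|ltiP] := leqP P i.
    by have := divn_gt0 i P0; rewrite lePi; case: (P <= i * m)%N; lia.
  by rewrite (divn_small ltiP); case: (P <= i * m)%N; case: ((i * m) %/ P)%N.
move: Esum; rewrite ![(\sum_(1 <= _ < _.+2) _)%N]big_nat_recl // expn1.
have leS : (\sum_(1 <= j < (i * m).+1) i %/ p ^ j.+1 <=
            \sum_(1 <= j < (i * m).+1) (i * m) %/ p ^ j.+1)%N.
  by apply: leq_sum => j _; rewrite leq_div2r // leq_pmulr.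
by have := double_div p (ltnW p1); lia.
Qed.

(** The right-hand side bounds from below the valuation of the i-th power of a
    number divisible by p ^ floor ((m - 1) / p).  It is large enough because a
    block longer than p has length at most 2 p floor ((m - 1) / p). *)
Lemma weight_big_block (p m i : nat) : (2 < p)%N -> (p < m)%N ->
  (weight p (i * m) <= i * ((m - 1) %/ p))%N.
Proof.
move=> p2 ltpm; case: i => [|i]; first by rewrite !mul0n weight0.
have p0 : (0 < p)%N by lia.
set c := ((m - 1) %/ p)%N.
have c0 : (0 < c)%N by rewrite divn_gt0; lia.
have lem : (m <= c.+1 * p)%N by have := ltn_ceil (m - 1) p0; rewrite -/c; lia.
apply: weight_leq_double => //; first by rewrite muln_gt0.
rewrite mulnCA -mulnA leq_mul2l /= (leq_trans lem) // leq_mul2r.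
by apply/orP; right; lia.
Qed.

(** * Exponential generating functions with highly divisible coefficients *)

(** Divisibility by M among the integers, for integers given as rational numbers;
    [dvdq 1] is integrality. *)
Definition dvdq (M : nat) (x : rat) : Prop := exists z : int, x = M%:R * z%:~R.

Lemma dvdqD M x x' : dvdq M x -> dvdq M x' -> dvdq M (x + x').
Proof. by move=> [z ->] [z' ->]; exists (z + z'); rewrite rmorphD mulrDr. Qed.

Lemma dvdqN M x : dvdq M x -> dvdq M (- x).
Proof. by move=> [z ->]; exists (- z); rewrite rmorphN mulrN. Qed.

Lemma dvdqB M x x' : dvdq M x -> dvdq M x' -> dvdq M (x - x').
Proof. by move=> Mx Mx'; apply: dvdqD => //; apply: dvdqN. Qed.

Lemma dvdq0 M : dvdq M 0.
Proof. by exists 0; rewrite mulr0. Qed.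

Lemma dvdq_sum M (I : Type) (r : seq I) (P : pred I) (F : I -> rat) :
  (forall i, P i -> dvdq M (F i)) -> dvdq M (\sum_(i <- r | P i) F i).
Proof.
by move=> MF; apply: big_ind => //; [exact: dvdq0 | exact: dvdqD].
Qed.

Lemma dvdqM M M' x x' : dvdq M x -> dvdq M' x' -> dvdq (M * M') (x * x').
Proof.
by move=> [z ->] [z' ->]; exists (z * z'); rewrite natrM rmorphM mulrACA.
Qed.

Lemma dvdq_dvd M M' x : (M %| M')%N -> dvdq M' x -> dvdq M x.
Proof.
move=> /dvdnP[k ->] [z ->]; exists (k%:Z * z).
by rewrite natrM rmorphM mulrA [M%:R * _]mulrC.
Qed.

Lemma dvdq1_int (z : int) : dvdq 1 z%:~R.
Proof. by exists z; rewrite mul1r. Qed.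

Lemma dvdq_nat M n : (M %| n)%N -> dvdq M n%:R.
Proof. by move=> Mn; apply: dvdq_dvd Mn _; exists 1; rewrite mulr1. Qed.

Lemma dvdq_int (M : nat) (z : int) : (M %| z)%Z -> dvdq M z%:~R.
Proof. by move=> /dvdzP[k ->]; exists k; rewrite rmorphM mulrC. Qed.

Lemma dvdq1M M x x' : dvdq 1 x -> dvdq M x' -> dvdq M (x * x').
Proof. by move=> dx dx'; have := dvdqM _ _ _ _ dx dx'; rewrite mul1n. Qed.

Lemma dvdq1X x n : dvdq 1 x -> dvdq 1 (x ^+ n).
Proof.
by move=> dx; elim: n => [|n IHn]; [exact: dvdq1_int 1 | rewrite exprS; apply: dvdq1M].
Qed.

(** The polynomial is read as an exponential generating function, hence the
    factorial. *)
Definition weighted (p : nat) (a : {poly rat}) : Prop :=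
  forall b, dvdq (p ^ weight p b) (b`!%:R * a`_b).

Lemma factq_neq0 n : n`!%:R != 0 :> rat.
Proof. by rewrite pnatr_eq0 -lt0n fact_gt0. Qed.

Lemma weighted0 p : weighted p 0.
Proof. by move=> b; rewrite coef0 mulr0; apply: dvdq0. Qed.

Lemma weightedD p a a' : weighted p a -> weighted p a' -> weighted p (a + a').
Proof. by move=> wa wa' b; rewrite coefD mulrDr; apply: dvdqD. Qed.

Lemma weighted_sum p (I : Type) (r : seq I) (F : I -> {poly rat}) :
  (forall i, weighted p (F i)) -> weighted p (\sum_(i <- r) F i).
Proof.
by move=> wF; apply: big_ind => //; [exact: weighted0 | exact: weightedD].
Qed.

Lemma bin_factq (n m : nat) : (m <= n)%N ->
  ('C(n, m))%:R = n`!%:R / (m`!%:R * (n - m)`!%:R) :> rat.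
Proof.
move=> lemn; rewrite -(bin_fact lemn) !natrM mulfK //.
by rewrite mulf_neq0 ?factq_neq0.
Qed.

(** The b-th coefficient of a product of exponential generating functions is a
    sum of terms C(b, i) times two coefficients, so the subadditivity of the
    weight applies to each of them. *)
Lemma weightedM p a a' : prime p -> weighted p a -> weighted p a' -> weighted p (a * a').
Proof.
move=> p_pr wa wa' b; rewrite coefM mulr_sumr; apply: dvdq_sum => i _.
have le_ib : (i <= b)%N by rewrite -ltnS.
have -> : b`!%:R * (a`_i * a'`_(b - i)) =
  ('C(b, i))%:R * ((i`!%:R * a`_i) * ((b - i)`!%:R * a'`_(b - i))).
  rewrite bin_factq //; field.
  by rewrite !factq_neq0.
apply: dvdq_dvd (dvdqM _ _ _ _ (dvdq_nat _ _ (dvdnn _)) (dvdqM _ _ _ _ (wa i) (wa' (b - i)%N))).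
have := weightD_bin p i (b - i) p_pr; rewrite subnKC // => le_w.
rewrite -expnD (dvdn_trans (dvdn_exp2l p le_w)) // expnD dvdn_mul //.
exact: pfactor_dvdnn.
Qed.

Lemma weighted_monomial p n (c : rat) :
  dvdq (p ^ weight p n) (n`!%:R * c) -> weighted p (c *: 'X^n).
Proof.
move=> dc b; rewrite coefZ coefXn; case: eqP => [->|_]; first by rewrite mulr1.
by rewrite !mulr0; apply: dvdq0.
Qed.

(** Unlike the powers, the divided powers a^i / i! of a sum are sums of products
    of divided powers of the summands, without binomial coefficients.  So this
    property passes from monomials to all their sums. *)
Definition divided_powers_weighted (p : nat) (a : {poly rat}) : Prop :=
  forall i, weighted p ((i`!%:R)^-1 *: a ^+ i).

Lemma divided_powers_weighted0 p : divided_powers_weighted p 0.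
Proof.
case=> [|i]; last by rewrite expr0n scaler0; apply: weighted0.
have -> : (0`!%:R)^-1 *: 0 ^+ 0 = 1 *: 'X^0 :> {poly rat}.
  by rewrite fact0 invr1 !expr0.
by apply: weighted_monomial; rewrite weight0 fact0 mulr1; apply: dvdq_nat.
Qed.

Lemma divided_powers_weightedD p a a' : prime p -> divided_powers_weighted p a ->
  divided_powers_weighted p a' -> divided_powers_weighted p (a + a').
Proof.
move=> p_pr wa wa' i; rewrite exprDn scaler_sumr; apply: weighted_sum => j.
have le_ji : (j <= i)%N by rewrite -ltnS.
rewrite -scaler_nat scalerA bin_factq // mulrA mulVf ?factq_neq0 // mul1r invfM.
rewrite mulrC -scalerA scalerAr scalerAl.
exact: weightedM.
Qed.

Lemma divided_powers_weighted_sum p (I : Type) (r : seq I) (P : pred I)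
    (F : I -> {poly rat}) : prime p ->
  (forall i, P i -> divided_powers_weighted p (F i)) ->
  divided_powers_weighted p (\sum_(i <- r | P i) F i).
Proof.
move=> p_pr wF; apply: big_ind => //; first exact: divided_powers_weighted0.
by move=> *; apply: divided_powers_weightedD.
Qed.

Lemma divided_powers_weighted_monomial p m (z : int) : (0 < m)%N ->
  (forall i, dvdq (p ^ weight p (i * m)) ((blocks m i)%:R * z%:~R ^+ i)) ->
  divided_powers_weighted p ((z%:~R / m`!%:R) *: 'X^m).
Proof.
move=> m0 dz i; rewrite exprZn scalerA -exprM mulnC; apply: weighted_monomial.
have -> : (i * m)`!%:R * (i`!%:R^-1 * (z%:~R / m`!%:R) ^+ i) =
  (blocks m i)%:R * z%:~R ^+ i :> rat; last by [].
rewrite -(blocks_fact m i m0) !natrM natrX expr_div_n.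
by field; rewrite expf_neq0 ?factq_neq0.
Qed.

(** * Negative powers of U_y and the negative binomial series *)

(** Power series are replaced by polynomials whose coefficients below degree L
    are the right ones. *)
Definition eq_upto (L : nat) (a a' : {poly rat}) : Prop :=
  forall m, (m < L)%N -> a`_m = a'`_m.

Lemma eq_upto_refl L a : eq_upto L a a.
Proof. by []. Qed.

Lemma eq_uptoM L a a' c c' : eq_upto L a a' -> eq_upto L c c' -> eq_upto L (a * c) (a' * c').
Proof.
move=> eqa eqc m ltmL; rewrite !coefM; apply: eq_bigr => i _.
by rewrite eqa ?eqc // (leq_ltn_trans _ ltmL) ?leq_subr // -ltnS.
Qed.

Lemma eq_uptoX L a n : eq_upto L a 1 -> eq_upto L (a ^+ n) 1.
Proof.
move=> eqa; elim: n => [|n IHn]; first by rewrite expr0.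
by rewrite exprS -[1]mulr1; apply: eq_uptoM.
Qed.

Lemma coef_exp_small d (a : {poly rat}) r m :
  (forall i, (i < d)%N -> a`_i = 0) -> (m < d * r)%N -> (a ^+ r)`_m = 0.
Proof.
move=> a0; elim: r m => [|r IHr] m; first by rewrite muln0.
rewrite mulnS => ltm; rewrite exprS coefM big1 // => i _.
have [ltid|ledi] := ltnP i d; first by rewrite a0 // mul0r.
rewrite IHr ?mulr0 //; have := ltn_ord i; lia.
Qed.

Lemma laurent_expE (f : laurent rat) n L :
  lshift_exp (laurent_exp f n) = n%:Z * lshift_exp f
  /\ forall m, (m < L)%N ->
     lcoef (laurent_exp f n) m = ((\poly_(i < L) lcoef f i) ^+ n)`_m.
Proof.
elim: n => [|n [IHs IHc]]; first by split=> [|m _]; rewrite ?mul0r // expr0 coef1.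
split=> [|m ltmL]; first by rewrite /= -/(laurent_exp f n) IHs; lia.
rewrite exprS coefM /= -/(laurent_exp f n); apply: eq_bigr => i _.
have ltiL : (i < L)%N by rewrite (leq_ltn_trans _ ltmL) // -ltnS.
by rewrite coef_poly ltiL IHc // (leq_ltn_trans _ ltmL) ?leq_subr.
Qed.

(** The series U_y(t) / t, whose constant coefficient is 1. *)
Definition unit_part (y : nat -> int) (L : nat) : {poly rat} :=
  \poly_(i < L) U_coef y i.+1.

Lemma U_coef1 y : y 0%N = 1 -> U_coef y 1 = 1.
Proof. by move=> y0; rewrite /U_coef /= y0 divr1. Qed.

Lemma unit_partV y L : y 0%N = 1 ->
  eq_upto L (unit_part y L * \poly_(i < L) lcoef (laurent_inv (U_series y)) i) 1.
Proof.
move=> y0 m ltmL.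
have U0 : lcoef (U_series y) 0 != 0 by rewrite /= U_coef1 ?oner_neq0.
have := laurent_mulfV m%:Z U0.
rewrite /laurent_coef /= addn0 => E; rewrite coef1 -E coefM.
apply: eq_bigr => i _.
have ltiL : (i < L)%N by rewrite (leq_ltn_trans _ ltmL) // -ltnS.
by rewrite !coef_poly ltiL (leq_ltn_trans _ ltmL) ?leq_subr.
Qed.

(** The truncated series of (1 + a)^(-n).  For n = 0 and r = 0 the truncated
    subtraction causes no trouble, since C(m, 0) = 1 for all m. *)
Definition neg_binomial (a : {poly rat}) (n L : nat) : {poly rat} :=
  \sum_(r < L) ((-1) ^+ r * ('C(n + r - 1, r))%:R) *: a ^+ r.

Lemma neg_binomial0 a L : neg_binomial a 0 L.+1 = 1.
Proof.
rewrite /neg_binomial big_ord_recl /= !expr0 mul1r bin0 scale1r big1 ?addr0 // => i _.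
by rewrite bin_small ?mulr0 ?scale0r //= /bump; lia.
Qed.

(** Pascal's rule makes the product telescope.  Keeping track of the remainder
    allows an induction on L without any assumption on a. *)
Lemma neg_binomialS (a : {poly rat}) n L :
  (1 + a) * neg_binomial a n.+1 L.+1 =
  neg_binomial a n L.+1 + ((-1) ^+ L * ('C(n + L, L))%:R) *: a ^+ L.+1.
Proof.
elim: L => [|L IHL].
  rewrite /neg_binomial !big_ord_recl !big_ord0 /= !addr0 !expr0 !bin0 !mulr1 !scale1r.
  by rewrite expr1 mulr1.
rewrite /neg_binomial big_ord_recr /= -/(neg_binomial a n.+1 L.+1) mulrDr IHL.
rewrite [in RHS]big_ord_recr /= -/(neg_binomial a n L.+1) -!addrA; congr (_ + _).
have -> : (n.+1 + L.+1 - 1 = (n + L).+1)%N by lia.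
have -> : (n + L.+1 - 1 = n + L)%N by lia.
have -> : (n + L.+1 = (n + L).+1)%N by lia.
rewrite binS natrD -!mul_polyC !rmorphM !rmorphD /= !rmorphXn /= rmorphN1.
rewrite !exprS; ring.
Qed.

Lemma neg_binomial_expV (a : {poly rat}) n L : (0 < L)%N -> a`_0 = 0 ->
  eq_upto L ((1 + a) ^+ n * neg_binomial a n L) 1.
Proof.
case: L => // L _ a0; elim: n => [|n IHn]; first by rewrite mul1r neg_binomial0.
rewrite exprSr -mulrA neg_binomialS mulrDr => m ltmL; rewrite coefD IHn //.
rewrite -scalerAr coefZ -[RHS]addr0; congr (_ + _).
rewrite coefM big1 ?mulr0 // => i _.
rewrite [X in _ * X](coef_exp_small 1) ?mulr0 //; first by case.
by rewrite mul1n; have := ltn_ord i; lia.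
Qed.

Lemma unit_part0 y L : y 0%N = 1 -> (0 < L)%N -> (unit_part y L - 1)`_0 = 0.
Proof. by move=> y0 L0; rewrite coefB coef_poly L0 U_coef1 // coef1 subrr. Qed.

(** Both the power of the inverse and the negative binomial series are inverses
    of [unit_part y L ^+ n] below degree L. *)
Lemma laurent_inv_expE y n L m : y 0%N = 1 -> (m < L)%N ->
  lcoef (laurent_exp (laurent_inv (U_series y)) n) m
  = (neg_binomial (unit_part y L - 1) n L)`_m.
Proof.
move=> y0 ltmL; have [_ ->//] := laurent_expE (laurent_inv (U_series y)) n L.
set Q := \poly_(_ < _) _; set P := unit_part y L; set T := neg_binomial _ _ _.
have PQ := eq_uptoX _ _ n (unit_partV y L y0); rewrite exprMn -/P -/Q in PQ.
have L0 := leq_ltn_trans (leq0n m) ltmL.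
have := neg_binomial_expV _ n L L0 (unit_part0 y L y0 L0).
rewrite -/P -/T addrC subrK => PT.
transitivity ((Q ^+ n * (P ^+ n * T))`_m).
  by have/(_ m ltmL) := eq_uptoM L _ _ _ _ (eq_upto_refl L (Q ^+ n)) PT; rewrite mulr1.
rewrite mulrA [_ * P ^+ n]mulrC.
by have/(_ m ltmL) := eq_uptoM L _ _ _ _ PQ (eq_upto_refl L T); rewrite mul1r.
Qed.

(** The polynomial G: the terms of U_y other than t and the one of degree p. *)
Definition other_blocks (y : nat -> int) (p L : nat) : {poly rat} :=
  \poly_(m < L.+1) (if (1 < m)%N && (m != p) then U_coef y m else 0).

Lemma unit_part_blocks y p L : y 0%N = 1 -> (1 < p <= L)%N ->
  'X * (unit_part y L - 1) = other_blocks y p L + U_coef y p *: 'X^p.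
Proof.
move=> y0 /andP[p1 lepL]; apply/polyP => m.
rewrite coefXM coefB coefD coefZ coefXn coef1 !coef_poly.
case: m => [|m] /=; first by rewrite (ltn_eqF (ltnW p1)) mulr0 addr0.
case: m => [|m] /=.
  have -> : (0 < L)%N by exact: leq_trans (ltnW p1) lepL.
  by rewrite (U_coef1 y y0) subrr (ltn_eqF p1) mulr0 addr0; case: ifP.
rewrite subr0 ltnS; case: (eqVneq m.+2 p) => [Ep|nep] /=; last first.
  by rewrite mulr0 addr0.
have -> : (m.+1 < L)%N by lia.
by rewrite mulr1 add0r Ep.
Qed.

Lemma other_blocks_small y p L m : (m < 2)%N -> (other_blocks y p L)`_m = 0.
Proof. by case: m => [|[|m]] // _; rewrite coef_poly ?if_same. Qed.

(** The partial exponential Bell polynomial: for a without constant term, it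
    counts the partitions of a b-set into r blocks, a block of size m having
    weight m! times the coefficient of a of degree m. *)
Definition bell (a : {poly rat}) (b r : nat) : rat := b`!%:R / r`!%:R * (a ^+ r)`_b.

(** The contribution of the exponents s and r.  The truncated
    subtractions are harmless: where one of them would be negative, one of the
    two binomial coefficients is 0. *)
Definition Rterm y p L N K s r : rat :=
  (-1) ^+ (s + r) * (y p./2)%:~R ^+ s * (blocks p s)%:R
  * ('C(N - 1 + s + r, s * p))%:R * ('C(N - 1 + s + r - s * p, K - 1))%:R
  * bell (other_blocks y p L) (N - 1 + s + r - s * p - (K - 1)) r.

Definition Rsum y p L S N K : rat := \sum_(s < S) \sum_(r < L) Rterm y p L N K s r.

(** Every term of [other_blocks] has degree at least 2, so r of them together
    have degree at least 2 r.  The bound gives the support of the double sum, and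
    for N < K also the vanishing of the whole sum. *)
Lemma Rterm_eq0 y p L N K s r : (1 < p)%N -> (0 < N)%N -> (0 < K)%N ->
  (N < s + r + K)%N -> Rterm y p L N K s r = 0.
Proof.
move=> p1 N0 K0 ltN; rewrite /Rterm.
have [lt1|le1] := ltnP (N - 1 + s + r) (s * p).
  by rewrite (bin_small lt1) mulr0 !mul0r.
have [lt2|le2] := ltnP (N - 1 + s + r - s * p) (K - 1).
  by rewrite (bin_small lt2) mulr0 !mul0r.
rewrite /bell (coef_exp_small 2) ?mulr0 //; first exact: other_blocks_small.
by have : (s * 2 <= s * p)%N by [rewrite leq_mul2l p1 orbT]; lia.
Qed.

Lemma sum_triangle L (f : nat -> nat -> rat) :
  (forall s r, (L <= s + r)%N -> f s r = 0) ->
  \sum_(n < L) \sum_(s < n.+1) f s (n - s)%N = \sum_(s < L) \sum_(r < L) f s r.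
Proof.
move=> f0.
under eq_bigr => n _ do rewrite (big_ord_widen L (fun s => f s (n - s)%N)) //.
rewrite (exchange_big_dep xpredT) //=; apply: eq_bigr => s _.
have lesL : (s <= L)%N := ltnW (ltn_ord s).
rewrite -(big_mkord (fun n => (s < n.+1)%N) (fun n => f s (n - s)%N)).
have := big_nat_widenl s 0 L xpredT (fun n => f s (n - s)%N) => /= <- //.
rewrite -{1}[nat_of_ord s]add0n big_addn -(big_mkord xpredT (fun r => f s r)).
rewrite [RHS](big_cat_nat (n := L - s)) ?leq_subr //=.
rewrite [X in _ = _ + X]big_nat_cond [X in _ = _ + X]big1 ?addr0; last first.
  by move=> r; rewrite andbT => /andP[ler _]; apply: f0; rewrite -leq_subLR.
by apply: eq_bigr => r _; rewrite addnK.
Qed.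

(** All binomial coefficients are quotients of factorials, and the two sides
    differ only in the grouping of these. *)
Lemma Rterm_coef y p L N K s r : odd p -> (0 < K <= N)%N ->
  (N - 1)`!%:R / (K - 1)`!%:R * ((-1) ^+ (s + r) * ('C(N + (s + r) - 1, s + r))%:R)
  * ((other_blocks y p L ^+ r * (U_coef y p *: 'X^p) ^+ s)`_(N - K + (s + r))
     * ('C(s + r, s))%:R) = Rterm y p L N K s r.
Proof.
move=> p_odd /andP[K0 leKN].
rewrite exprZn -exprM -scalerAr coefZ coefMXn mulnC /Rterm.
have -> : (N - 1 + s + r = N + (s + r) - 1)%N by lia.
have [lt1|le1] := ltnP (N + (s + r) - 1) (s * p).
  rewrite (bin_small lt1) mulr0 !mul0r.
  have -> : (N - K + (s + r) < s * p)%N by lia.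
  by rewrite mulr0 mul0r mulr0.
have [lt2|le2] := ltnP (N + (s + r) - 1 - s * p) (K - 1).
  rewrite (bin_small lt2) mulr0 !mul0r.
  have -> : (N - K + (s + r) < s * p)%N by lia.
  by rewrite mulr0 mul0r mulr0.
have -> : (N - K + (s + r) < s * p)%N = false by lia.
have Eb : (N - K + (s + r) - s * p = N + (s + r) - 1 - s * p - (K - 1))%N by lia.
rewrite /bell Eb; set b := (_ - (K - 1))%N; set A := (_ - s * p)%N in le2 b *.
have -> : ('C(A, K - 1))%:R = A`!%:R / ((K - 1)`!%:R * b`!%:R) :> rat.
  exact: bin_factq.
rewrite (bin_factq _ _ le1) -/A.
have -> : ('C(s + r, s))%:R = (s + r)`!%:R / (s`!%:R * r`!%:R) :> rat.
  by rewrite bin_factq ?leq_addr // addKn.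
have -> : ('C(N + (s + r) - 1, s + r))%:R
    = (N + (s + r) - 1)`!%:R / ((s + r)`!%:R * (N - 1)`!%:R) :> rat.
  by rewrite bin_factq; [congr (_ / (_ * _`!%:R)); lia | lia].
have -> : (blocks p s)%:R = (s * p)`!%:R / (s`!%:R * p`!%:R ^+ s) :> rat.
  rewrite -(blocks_fact p s) ?odd_gt0 // !natrM natrX mulfK //.
  by rewrite mulf_neq0 ?expf_neq0 ?factq_neq0.
rewrite /U_coef p_odd expr_div_n; field.
by rewrite !expf_neq0 ?factq_neq0.
Qed.

(** The bounds L and S of the two sums are free, as the terms beyond N vanish;
    this makes the sums for different N comparable. *)
Lemma Rinv_sum y p L S N K : y 0%N = 1 -> odd p -> (1 < p <= L)%N ->
  (0 < N < L)%N -> (N < S)%N -> (0 < K)%N ->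
  Rinv y N K = 2 ^ ((N%:Z - K%:Z) %/ 2)%Z * Rsum y p L S N K.
Proof.
move=> y0 p_odd /andP[p1 lepL] /andP[N0 ltNL] ltNS K0.
have term0 s r : (N < s + r + K)%N -> Rterm y p L N K s r = 0 by exact: Rterm_eq0.
have -> : Rsum y p L S N K = \sum_(s < L) \sum_(r < L) Rterm y p L N K s r.
  rewrite /Rsum -!(big_mkord xpredT (fun s => \sum_(r < L) Rterm y p L N K s r)).
  have trunc T : (N < T)%N -> \sum_(0 <= s < T) \sum_(r < L) Rterm y p L N K s r
    = \sum_(0 <= s < N.+1) \sum_(r < L) Rterm y p L N K s r.
    move=> ltNT; rewrite (big_cat_nat (n := N.+1)) //=.
    rewrite [X in _ + X]big_nat_cond [X in _ + X]big1 ?addr0 // => s.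
    by rewrite andbT => /andP[les _]; rewrite big1 // => r _; rewrite term0 //; lia.
  by rewrite !trunc.
case: K K0 term0 => // K _ term0; case: N N0 ltNL ltNS term0 => // N _ ltNL ltNS term0.
rewrite /Rinv -mulrA; congr (_ * _).
have [Esh _] := laurent_expE (laurent_inv (U_series y)) N.+1 L.
rewrite mulrN1 in Esh; rewrite /laurent_coef Esh lerN2 lez_nat ltnS.
have [leKN|ltNK] := leqP K N; last first.
  rewrite mulr0 big1 // => s _; rewrite big1 // => r _.
  by rewrite term0 //; lia.
have -> : `|- K.+1%:Z - - N.+1%:Z|%N = (N.+1 - K.+1)%N by lia.
rewrite (laurent_inv_expE y N.+1 L) //; last by lia.
rewrite /neg_binomial coef_sum mulr_sumr.
rewrite -(sum_triangle L (fun s r => Rterm y p L N.+1 K.+1 s r)); last first.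
  by move=> s r leL; rewrite term0 //; lia.
apply: eq_bigr => n _; rewrite coefZ.
(* Multiplying by t^n turns the shifted series into U_y - t itself. *)
have -> : ((unit_part y L - 1) ^+ n)`_(N.+1 - K.+1) =
  (('X * (unit_part y L - 1)) ^+ n)`_(N.+1 - K.+1 + n).
  by rewrite exprMn coefXnM ltnNge leq_addl addnK.
rewrite (unit_part_blocks y p) ?p1 // exprDn coef_sum !mulr_sumr.
apply: eq_bigr => s _; rewrite coefMn.
have le_sn : (s <= n)%N by rewrite -ltnS.
move: (nat_of_ord s) le_sn => {}s le_sn.
have [r En] : exists r, nat_of_ord n = (s + r)%N by exists (n - s)%N; rewrite subnKC.
rewrite En addKn -[_ *+ 'C(_, s)]mulr_natr -(Rterm_coef y p L) // mulrA !subn1 //.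
Qed.

(** * Congruences modulo powers of p *)

(** From i C(p^e, i) = p^e C(p^e - 1, i - 1): only the p-part of i, at most
    p^(floor (log_p A)), can be lost. *)
Lemma dvdn_trunc_log_bin (p e A i : nat) : prime p -> (0 < i <= A)%N ->
  (p ^ e %| p ^ trunc_log p A * 'C(p ^ e, i))%N.
Proof.
move=> p_pr /andP[i0 leiA]; case: i i0 leiA => // i _ leiA.
have dvd_iC : (p ^ e %| i.+1 * 'C(p ^ e, i.+1))%N.
  by rewrite -mul_bin_diag dvdn_mulr.
have [u cop_pu Ei] := pfactor_coprime p_pr (ltn0Sn i).
have le_v : (logn p i.+1 <= trunc_log p A)%N.
  rewrite (leq_trans _ (leq_trunc_log p leiA)) // trunc_log_max ?prime_gt1 //.
  by rewrite dvdn_leq // pfactor_dvdnn.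
have dvdC : (p ^ e %| p ^ logn p i.+1 * 'C(p ^ e, i.+1))%N.
  by rewrite -(@Gauss_dvdr _ u) ?coprimeXl // mulnA -Ei.
by rewrite (dvdn_trans dvdC) // dvdn_mul // dvdn_exp2l.
Qed.

(** In Vandermonde's formula for C(x + p^e, A), every term but C(x, A) contains a
    factor C(p^e, i) with 0 < i <= A. *)
Lemma bin_shift_ppow (p e x A : nat) : prime p ->
  exists2 z, 'C(x + p ^ e, A) = ('C(x, A) + z)%N & (p ^ e %| p ^ trunc_log p A * z)%N.
Proof.
move=> p_pr; exists (\sum_(j < A) 'C(x, j) * 'C(p ^ e, A - j))%N.
  by rewrite -binomial.Vandermonde big_ord_recr /= subnn bin0 muln1 addnC.
rewrite big_distrr /=; apply: dvdn_sum => j _; rewrite mulnCA dvdn_mull //.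
by rewrite dvdn_trunc_log_bin // subn_gt0 ltn_ord leq_subr.
Qed.

(** In a^p - b^p = (a - b) (a^(p-1) + ... + b^(p-1)) the second factor is
    congruent to p b^(p-1), hence to 0, modulo p. *)
Lemma dvdz_lift_step (p e : nat) (a b : int) :
  ((p ^ e.+1)%N %| a - b)%Z -> ((p ^ e.+2)%N %| a ^+ p - b ^+ p)%Z.
Proof.
move=> dab; rewrite subrXX (_ : (p ^ e.+2)%N%:Z = (p ^ e.+1)%N%:Z * p%:Z); last first.
  by rewrite -PoszM -expnSr.
apply: dvdz_mul => //.
have dpab : (p %| a - b)%Z.
  by apply: dvdz_trans dab; rewrite dvdzE /= expnS dvdn_mulr.
have -> : \sum_(i < p) a ^+ (p.-1 - i) * b ^+ i =
  \sum_(i < p) (a ^+ (p.-1 - i) - b ^+ (p.-1 - i)) * b ^+ i + p%:Z * b ^+ p.-1.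
  rewrite -[p%:Z]natz mulr_natl -[X in _ *+ X]card_ord -sumr_const -big_split /=.
  apply: eq_bigr => i _; rewrite mulrBl -exprD subnK ?subrK //.
  by have := ltn_ord i; lia.
rewrite rpredD ?dvdz_mulr // rpred_sum // => i _.
by rewrite dvdz_mulr // subrXX dvdz_mulr.
Qed.

Lemma dvdz_lift (p e : nat) (a b : int) :
  (p %| a - b)%Z -> ((p ^ e.+1)%N %| a ^+ (p ^ e) - b ^+ (p ^ e))%Z.
Proof.
move=> dab; elim: e => [|e IHe]; first by rewrite expn1 !expr1.
by rewrite expnSr !exprM; apply: dvdz_lift_step.
Qed.

Lemma prod_shift_period (R : comPzRingType) (M a : nat) (f : nat -> R) :
  (forall j, f (j + M)%N = f j) ->
  \prod_(a <= j < a + M) f j = \prod_(0 <= j < M) f j.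
Proof.
move=> fM; elim: a => [|a <-]; first by rewrite add0n.
case: M fM => [|M] fM; first by rewrite !addn0 !big_geq.
rewrite [RHS]big_ltn ?addnS ?ltnS ?leq_addr // addSn big_nat_recr ?leq_addr //=.
by rewrite -addnS fM mulrC.
Qed.

(** The numbers prime to p among p^(e+1) consecutive ones represent all units of
    the ring, and inversion permutes these; so their product is its own
    inverse. *)
Lemma unit_prod_sqr (p e a : nat) : prime p ->
  (\prod_(a <= j < a + p ^ e.+1 | coprime p j) (j%:R : 'Z_(p ^ e.+1))) ^+ 2 = 1.
Proof.
move=> p_pr; set M := (p ^ e.+1)%N.
have M1 : (1 < M)%N by rewrite -(exp1n e.+1) ltn_exp2r ?prime_gt1.
rewrite big_mkcond prod_shift_period => [|j]; last first.
  have -> : coprime p (j + M) = coprime p j.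
    by rewrite !(prime_coprime _ p_pr) dvdn_addl // /M expnS dvdn_mulr.
  by rewrite natrD -[M%:R]Zp_nat_mod // modnn addr0.
have -> : index_iota 0 M = index_iota 0 (Zp_trunc M).+2 by rewrite Zp_cast.
rewrite big_mkord.
rewrite (eq_bigr (fun x : 'Z_M => if x \is a GRing.unit then x else 1)); last first.
  move=> x _; rewrite -[in RHS](natr_Zp x) unitZpE // coprime_pexpl //.
rewrite -big_mkcond /=; set P := \prod_(x | _) x.
have PV : P = \prod_(x : 'Z_M | x \is a GRing.unit) x^-1.
  by rewrite /P (reindex_inj invr_inj); apply: eq_bigl => x; rewrite unitrV.
rewrite expr2 {2}PV /P.
by rewrite -big_split /= big1 // => x Ux; rewrite divrr.
Qed.

(** Products over the integers prime to p in an interval of length p are, up to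
    (p - 1)!, the factors of [blocks p]. *)
Lemma units_block (p k : nat) : (0 < p)%N ->
  (\prod_(i < p - 1) (k * p + i.+1) = 'C(k.+1 * p - 1, p - 1) * (p - 1)`!)%N.
Proof.
move=> p0; rewrite bin_ffact ffact_prod (reindex_inj rev_ord_inj) /=.
apply: eq_bigr => i _; have := ltn_ord i; rewrite mulSn => lti.
by lia.
Qed.

Lemma coprime_block (R : comPzRingType) (p k : nat) (f : nat -> R) : prime p ->
  \prod_(k * p <= j < k.+1 * p | coprime p j) f j = \prod_(i < p - 1) f (k * p + i.+1)%N.
Proof.
move=> p_pr; have p0 := prime_gt0 p_pr.
rewrite -[X in \prod_(X <= _ < _ | _) _]add0n big_addn mulSn addnK.
rewrite -{1}(prednK p0) big_mkcond big_nat_recl //= add0n.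
rewrite (prime_coprime _ p_pr) dvdn_mull // mul1r big_mkord -subn1.
apply: eq_bigr => i _; rewrite addnC ifT // (prime_coprime _ p_pr) dvdn_addr ?dvdn_mull //.
by rewrite gtnNdvd //; have := ltn_ord i; lia.
Qed.

Lemma unit_prod_blocks (R : comPzRingType) (p s q : nat) : prime p ->
  \prod_(s * p <= j < (s + q) * p | coprime p j) (j%:R : R) =
  (\prod_(s <= k < s + q) 'C(k.+1 * p - 1, p - 1))%N%:R * ((p - 1)`!%:R) ^+ q.
Proof.
move=> p_pr; elim: q => [|q IHq].
  by rewrite addn0 !big_geq // mulr1.
rewrite (big_cat_nat (n := ((s + q) * p)%N)) ?leq_mul2r ?leq_addr ?leq_add2l ?leqnSn ?orbT //=.
rewrite IHq addnS coprime_block // -natr_prod units_block ?prime_gt0 //.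
by rewrite big_nat_recr ?leq_addr //= !natrM exprS; ring.
Qed.

Lemma dvdz_of_Zp (M : nat) (z : int) : (1 < M)%N -> z%:~R = 0 :> 'Z_M -> (M %| z)%Z.
Proof.
move=> M1; have nat0 n : n%:R = 0 :> 'Z_M -> (M %| n)%N.
  by move/(congr1 val) => /=; rewrite val_Zp_nat // => E; apply/eqP.
rewrite dvdzE; case: z => n; first by exact: nat0.
by rewrite NegzE rmorphN /= => /eqP; rewrite oppr_eq0 => /eqP; exact: nat0.
Qed.

(** The quotient Y of the two numbers is a product of p^e consecutive factors of
    [blocks].  Up to a power of (p - 1)!, whose square is 1 by Wilson's theorem,
    Y is a product over units, so Y^2 = 1 modulo p^(e+1).  As Y = 1 modulo p,
    the factor Y + 1 of Y^2 - 1 is prime to p. *)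
Lemma blocks_shift (p e s : nat) : prime p -> (2 < p)%N ->
  ((p ^ e.+1)%N %| (blocks p (s + p ^ e))%:Z - (blocks p s)%:Z)%Z.
Proof.
move=> p_pr p2; set q := (p ^ e)%N; set M := (p ^ e.+1)%N.
have M1 : (1 < M)%N by rewrite -(exp1n e.+1) ltn_exp2r ?prime_gt1.
set Y := (\prod_(s <= k < s + q) 'C(k.+1 * p - 1, p - 1))%N.
have -> : blocks p (s + q) = (blocks p s * Y)%N.
  rewrite /blocks -!(big_mkord xpredT (fun k => 'C(k.+1 * p - 1, p - 1))).
  by rewrite (big_cat_nat (n := s)) ?leq_addr.
rewrite PoszM -{2}[(blocks p s)%:Z]mulr1 -mulrBr dvdz_mull //.
have Wil : (p %| ((p - 1)`!)%:Z - (-1))%Z.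
  by rewrite opprK dvdzE /= addn1 subn1 -Wilson // prime_gt1.
have F2 : (M %| (((p - 1)`!)%:Z ^+ q) ^+ 2 - 1)%Z.
  have := dvdz_lift p e _ _ Wil; rewrite -/q -/M => dW.
  have E1 : ((-1) ^+ q) ^+ 2 = 1 :> int.
    by rewrite -exprM mulnC exprM sqrrN !expr1n.
  by rewrite -[X in _ - X]E1 subrXX dvdz_mulr.
have Y2 : (M %| Y%:Z ^+ 2 - 1)%Z.
  have : (Y%:R * (p - 1)`!%:R ^+ q) ^+ 2 = 1 :> 'Z_M.
    rewrite -unit_prod_blocks // mulnDl -expnSr; exact: unit_prod_sqr.
  rewrite exprMn => E.
  have Z2 : (Y%:Z ^+ 2 * (((p - 1)`!)%:Z ^+ q) ^+ 2 - 1)%:~R = 0 :> 'Z_M.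
    by rewrite rmorphB rmorphM !rmorphXn /= -!pmulrn E subrr.
  have := dvdz_of_Zp _ _ M1 Z2.
  set F := _ ^+ 2 in F2 *; set Y' := _ ^+ 2 => dvdYF.
  have -> : Y' - 1 = (Y' * F - 1) - Y' * (F - 1) by ring.
  by rewrite rpredB // dvdz_mull.
have Y1 : (p %| Y%:Z - 1)%Z.
  rewrite (dvdz_pcharf (pchar_Fp p_pr)) rmorphB /= subr_eq0 -pmulrn natr_prod.
  rewrite big1 // => k _; have F0 : (p - 1)`!%:R != 0 :> 'F_p.
    rewrite -(dvdn_pcharf (pchar_Fp p_pr)); apply/negP => dF.
    move: Wil; rewrite opprK dvdzE /= => dF1.
    by have := dvdn_addr 1 dF; rewrite dF1 dvdn1 => /esym/eqP Ep; rewrite Ep in p2.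
  apply: (mulIf F0); rewrite mul1r -natrM -units_block ?prime_gt0 // natr_prod.
  rewrite fact_prod big_add1 subn1 /= natr_prod big_mkord; apply: eq_bigr => i _.
  by rewrite natrD natrM (pcharf0 (pchar_Fp p_pr)) mulr0 add0r.
have cop : coprimez M (Y%:Z + 1).
  rewrite /coprimez -[_ == _]/(coprime _ _) /= coprime_pexpl // prime_coprime // .
  apply/negP => dY; have : (p %| 2%:Z)%Z.
    have -> : 2%:Z = (Y%:Z + 1) - (Y%:Z - 1) by lia.
    by rewrite rpredB.
  by rewrite dvdzE /= => /dvdn_leq => /(_ isT); rewrite leqNgt p2.
by rewrite -(Gauss_dvdzl _ cop) -subr_sqr_1.
Qed.

(** The argument of Gauss: among 2, 4, ..., 4m, the numbers above 2m are, modulo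
    p = 4m + 1, the opposites of the odd numbers below 2m.  Hence the product
    2^(2m) (2m)! equals (-1)^m (2m)! modulo p. *)
Lemma two_pow_half (m : nat) : prime (4 * m + 1) ->
  ((4 * m + 1)%N %| 2 ^+ (2 * m) - (-1) ^+ m)%Z.
Proof.
set p := (4 * m + 1)%N => p_pr; have charp := pchar_Fp p_pr.
rewrite (dvdz_pcharf charp) rmorphB !rmorphXn rmorphN1 /= subr_eq0; apply/eqP.
have F0 : (2 * m)`!%:R != 0 :> 'F_p.
  rewrite -(dvdn_pcharf charp) -[X in (X %| _)%N]expn1 pfactor_dvdn ?fact_gt0 //.
  by rewrite logn_fact_lt // /p; lia.
apply: (mulIf F0).
have negE a b : (a + b = p)%N -> a%:R = - b%:R :> 'F_p.
  by move=> Eab; apply/eqP; rewrite -addr_eq0 -natrD Eab (pcharf0 charp).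
have EF : (2 * m)`! = (\prod_(i < 2 * m) i.+1)%N.
  by rewrite fact_prod big_add1 /= big_mkord.
have E1 : 2 ^+ (2 * m) * (2 * m)`!%:R = \prod_(i < 2 * m) (2 * i.+1)%:R :> 'F_p.
  rewrite EF natr_prod -[X in _ ^+ X]card_ord -prodr_const -big_split /=.
  by apply: eq_bigr => i _; rewrite natrM.
have E2 : (2 * m)`!%:R = \prod_(i < m) (2 * i.+1)%:R * \prod_(i < m) (2 * i + 1)%:R :> 'F_p.
  rewrite EF natr_prod; elim: (m) => [|n IHn]; first by rewrite muln0 !big_ord0 mulr1.
  rewrite (_ : 2 * n.+1 = (2 * n).+2)%N; last by lia.
  rewrite !big_ord_recr /= IHn addn1 (_ : (2 * n).+2 = 2 * n.+1)%N; last by lia.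
  by ring.
rewrite E1 E2 (_ : 2 * m = m + m)%N; last by lia.
rewrite big_split_ord /= mulrCA; congr (_ * _).
rewrite (reindex_inj rev_ord_inj) /= -[X in _ ^+ X]card_ord -prodrN.
apply: eq_bigr => i _; apply: negE; have := ltn_ord i; rewrite /p; lia.
Qed.

(** * Divisibility of the terms of the double sum *)

Definition steep_valuations (p : nat) (y : nat -> int) : Prop :=
  forall h : nat, (0 < h)%N ->
    forall n : nat, (uphalf (h * p) <= n)%N -> valuation_ge p (y n) h.

Lemma valuation_geP p (z : int) h : prime p -> valuation_ge p z h -> ((p ^ h)%N %| z)%Z.
Proof.
move=> p_pr /orP[/eqP-> //|leh]; rewrite dvdzE /=.
have [->//|z0] := posnP `|z|%N; by rewrite pfactor_dvdn.
Qed.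

(** A term of degree m = 2j + 1 > p has y(j) divisible by p^c with
    c = floor ((m - 1) / p), because c p <= 2j. *)
Lemma other_blocks_weighted p y L : prime p -> (2 < p)%N -> steep_valuations p y ->
  divided_powers_weighted p (other_blocks y p L).
Proof.
move=> p_pr p2 y_val; rewrite /other_blocks poly_def; apply: divided_powers_weighted_sum => // m _.
case: ifP => [/andP[m1 nemp]|_]; last by rewrite scale0r; apply: divided_powers_weighted0.
rewrite /U_coef; case: ifP => [m_odd|_]; last by rewrite scale0r; apply: divided_powers_weighted0.
apply: divided_powers_weighted_monomial => [|i]; first exact: ltnW.
have [ltmp|ltpm] : (m < p)%N \/ (p < m)%N by lia.
  rewrite -[(p ^ _)%N]muln1; apply: dvdqM; last by apply: dvdq1X; apply: dvdq1_int.
  apply: dvdq_nat; rewrite pfactor_dvdn ?blocks_gt0 ?weight_small_blocks ?m1 ?(ltnW m1) //.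
rewrite -[(p ^ _)%N]mul1n; apply: dvdqM; first by apply: dvdq_nat; rewrite dvd1n.
rewrite -rmorphXn; apply: dvdq_int.
set c := ((m - 1) %/ p)%N.
have c0 : (0 < c)%N by rewrite divn_gt0 ?prime_gt0 //; lia.
have dy : ((p ^ c)%N %| y m./2)%Z.
  apply: valuation_geP => //; apply: y_val => //.
  have := leq_trunc_div (m - 1) p; rewrite -/c => lec; lia.
apply: dvdz_trans (dvdz_exp2r i dy).
have -> : (p ^ c)%N%:Z ^+ i = (p ^ (i * c))%N%:Z.
  by rewrite mulnC expnM -[in RHS]natz natrX natz.
by rewrite dvdzE /= dvdn_exp2l // weight_big_block.
Qed.

Lemma bell_weighted p y L b r : prime p -> (2 < p)%N -> steep_valuations p y ->
  dvdq (p ^ weight p b) (bell (other_blocks y p L) b r).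
Proof.
move=> p_pr p2 y_val; have := other_blocks_weighted p y L p_pr p2 y_val r b.
by rewrite coefZ mulrA.
Qed.

(** The part of a term that depends on s and N only through A, together with the
    power of p by which the whole sequence is multiplied. *)
Definition rest_term y p L K A r : rat :=
  (p ^ (K %/ p))%:R * (('C(A, K - 1))%:R * bell (other_blocks y p L) (A - (K - 1)) r).

(** Subadditivity of the weight for A = (K - 1) + b; the power of p pays for the
    weight of K - 1. *)
Lemma rest_term_weighted p y L K A r : prime p -> (2 < p)%N -> steep_valuations p y ->
  (0 < K)%N -> dvdq (p ^ weight p A) (rest_term y p L K A r).
Proof.
move=> p_pr p2 y_val K0; rewrite /rest_term.
have [lt|le] := ltnP A (K - 1); first by rewrite bin_small // mul0r mulr0; apply: dvdq0.
set b := (A - (K - 1))%N.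
apply: dvdq_dvd (dvdqM _ _ _ _ (dvdq_nat _ _ (dvdnn _))
                   (dvdqM _ _ _ _ (dvdq_nat _ _ (dvdnn _))
                      (bell_weighted p y L b r p_pr p2 y_val))).
have leK : (weight p (K - 1) <= K %/ p)%N.
  by apply: weight_le => //; have := ltn_ceil K (prime_gt0 p_pr); lia.
have := weightD_bin p (K - 1) b p_pr; rewrite /b subnKC // => leA.
rewrite (@dvdn_trans (p ^ (K %/ p + (logn p 'C(A, K - 1) + weight p b)))) //.
  by rewrite dvdn_exp2l // /b; lia.
by rewrite !expnD dvdn_mul // dvdn_mul // pfactor_dvdnn.
Qed.

Lemma Rsum_eq0 p y L S N K : (1 < p)%N -> (0 < N < K)%N -> Rsum y p L S N K = 0.
Proof.
move=> p1 /andP[N0 ltNK]; rewrite /Rsum big1 // => s _; rewrite big1 // => r _.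
by apply: Rterm_eq0 => //; lia.
Qed.

Lemma scaled_RtermE p y L N K s r A : (N - 1 + s + r = A + s * p)%N ->
  (p ^ (K %/ p))%:R * Rterm y p L N K s r =
  ((-1) ^+ (s + r) * (y p./2)%:~R ^+ s) * (blocks p s * 'C(A + s * p, A))%:R
  * rest_term y p L K A r.
Proof.
move=> EA; rewrite /Rterm EA addnK /rest_term natrM.
rewrite -(bin_sub (leq_addr (s * p) A)) addKn.
by ring.
Qed.

Lemma Rterm_lt p y L N K s r : (N - 1 + s + r < s * p)%N ->
  Rterm y p L N K s r = 0.
Proof. by move=> lt; rewrite /Rterm (bin_small lt) mulr0 !mul0r. Qed.

Lemma scaled_Rterm_int p y L N K s r : prime p -> (2 < p)%N -> steep_valuations p y ->
  (0 < K)%N ->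
  dvdq 1 ((p ^ (K %/ p))%:R * Rterm y p L N K s r).
Proof.
move=> p_pr p2 y_val K0; have [lt|le] := ltnP (N - 1 + s + r) (s * p).
  by rewrite Rterm_lt // mulr0; apply: dvdq0.
have EA := subnK le; rewrite (scaled_RtermE _ _ _ _ _ _ _ _ (esym EA)) -mulrA.
apply: dvdq1M.
  by apply: dvdq1M; apply: dvdq1X; [exact: (dvdq1_int (-1)) | exact: dvdq1_int].
apply: dvdq1M; first exact: dvdq_nat.
by apply: dvdq_dvd (rest_term_weighted p y L K _ r p_pr p2 y_val K0); rewrite dvd1n.
Qed.

Lemma scaled_Rsum_int p y L S N K : prime p -> (2 < p)%N -> steep_valuations p y ->
  (0 < K)%N -> dvdq 1 ((p ^ (K %/ p))%:R * Rsum y p L S N K).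
Proof.
move=> p_pr p2 y_val K0; rewrite mulr_sumr; apply: dvdq_sum => s _; rewrite mulr_sumr.
by apply: dvdq_sum => r _; apply: scaled_Rterm_int.
Qed.

Lemma Rinv_even p y L S n k : y 0%N = 1 -> odd p -> (1 < p)%N -> (p <= L)%N -> (0 < n)%N ->
  (0 < k)%N -> (2 * n < L)%N -> (2 * n < S)%N ->
  Rinv y (2 * n) (2 * k) = 2 ^+ (n - k) * Rsum y p L S (2 * n) (2 * k).
Proof.
move=> y0 p_odd p1 lepL n0 k0 ltL ltS.
rewrite (Rinv_sum y p L S) //; try lia.
have [lekn|ltnk] := leqP k n.
  congr (_ * _); have -> : ((2 * n)%N%:Z - (2 * k)%N%:Z = (n - k)%N%:Z * 2)%R by lia.
  by rewrite mulzK.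
by rewrite Rsum_eq0 ?mulr0 //; lia.
Qed.

(** Here A is the same for both terms, and the exponent p^e is odd, so that the
    sign changes. *)
Lemma Rterm_shift p y L e N K s r : prime p -> (2 < p)%N -> steep_valuations p y ->
  (0 < N)%N -> (0 < K)%N ->
  dvdq (p ^ e.+1)
    ((p ^ (K %/ p))%:R * Rterm y p L (N + p ^ e * (p - 1)) K (s + p ^ e) r
     + (y p./2)%:~R ^+ (p ^ e) * ((p ^ (K %/ p))%:R * Rterm y p L N K s r)).
Proof.
move=> p_pr p2 y_val N0 K0; set q := (p ^ e)%N; have p0 := prime_gt0 p_pr.
have q0 : (0 < q)%N by rewrite expn_gt0 p0.
have Eq : (q * (p - 1) + q = q * p)%N by rewrite addnC -mulnS subn1 prednK.
have [lt|le] := ltnP (N - 1 + s + r) (s * p).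
  rewrite !Rterm_lt ?mulr0 ?addr0 //; first exact: dvdq0.
  by rewrite mulnDl; lia.
have EA : exists A, (N - 1 + s + r = A + s * p)%N.
  by exists (N - 1 + s + r - s * p)%N; rewrite subnK.
case: EA => A EA; rewrite (scaled_RtermE _ _ _ _ _ _ _ _ EA).
rewrite (scaled_RtermE _ _ _ _ _ _ _ A); last first.
  by rewrite mulnDl; lia.
have -> : (A + (s + q) * p = A + s * p + p ^ e.+1)%N by rewrite expnSr mulnDl addnA.
have [z -> dvdz] := bin_shift_ppow p e.+1 (A + s * p) A p_pr.
have [w Ew] := rest_term_weighted p y L K A r p_pr p2 y_val K0.
have q_odd : odd q by rewrite oddX; case: (even_prime p_pr) p2 => [->//|->]; rewrite orbT.
set x := (y p./2)%:~R; set B' := blocks p (s + q); set B := blocks p s.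
set C := 'C(_, A); set Z := rest_term _ _ _ _ _ _.
have sgn : (-1) ^+ (s + q + r) = - (-1) ^+ (s + r) :> rat.
  by rewrite addnAC exprD -[in (-1) ^+ q]signr_odd q_odd expr1 mulrN1.
have -> : (-1) ^+ (s + q + r) * x ^+ (s + q) * (B' * (C + z))%:R * Z
   + x ^+ q * ((-1) ^+ (s + r) * x ^+ s * (B * C)%:R * Z)
  = - ((-1) ^+ (s + r) * x ^+ (s + q)) * ((B'%:R - B%:R) * C%:R * Z + B'%:R * (z%:R * Z)).
  by rewrite sgn !natrM natrD [x ^+ (s + q)]exprD; ring.
apply: dvdq1M.
  by apply: dvdqN; apply: dvdq1M; apply: dvdq1X; [exact: (dvdq1_int (-1)) | exact: dvdq1_int].
have Z1 : dvdq 1 Z.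
  by apply: dvdq_dvd (rest_term_weighted p y L K A r p_pr p2 y_val K0); rewrite dvd1n.
apply: dvdqD.
  rewrite -[(p ^ e.+1)%N]muln1; apply: dvdqM => //.
  rewrite -[(p ^ e.+1)%N]muln1; apply: dvdqM; last exact: dvdq_nat.
  have -> : B'%:R - B%:R = (B'%:Z - B%:Z)%:~R :> rat by rewrite rmorphB /= -!pmulrn.
  by apply: dvdq_int; apply: blocks_shift.
apply: dvdq1M; first exact: dvdq_nat.
rewrite /Z Ew mulrA -natrM -[(p ^ e.+1)%N]muln1; apply: dvdqM; last exact: dvdq1_int.
apply: dvdq_nat; rewrite mulnC (dvdn_trans dvdz) // dvdn_mul // dvdn_exp2l //.
exact: leq_maxl.
Qed.

(** If A + s p reaches p^(e+1), then C(A + s p, A) is compared with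
    C(A + s p - p^(e+1), A), which vanishes as s p < p^(e+1).  Otherwise
    N + r <= p^e - s, and this forces A to be at least 2 (e + 1) p. *)
Lemma Rterm_low p y L e N K s r : prime p -> (2 < p)%N -> steep_valuations p y ->
  (2 * e.+2 <= N)%N -> (0 < K)%N -> (s < p ^ e)%N ->
  dvdq (p ^ e.+1) ((p ^ (K %/ p))%:R * Rterm y p L (N + p ^ e * (p - 1)) K s r).
Proof.
move=> p_pr p2 y_val leN K0; set q := (p ^ e)%N => ltsq.
have p0 := prime_gt0 p_pr; have p1 := prime_gt1 p_pr.
have Eq : (q * (p - 1) + q = q * p)%N by rewrite addnC -mulnS subn1 prednK.
have lesp : (s * (p - 1) <= q * (p - 1))%N by rewrite leq_mul2r ltnW ?orbT.
have Es : (s * (p - 1) + s = s * p)%N by rewrite addnC -mulnS subn1 prednK.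
pose A := (N + q * (p - 1) - 1 + s + r - s * p)%N.
have EA : (N + q * (p - 1) - 1 + s + r = A + s * p)%N by rewrite /A subnK //; lia.
rewrite (scaled_RtermE _ _ _ _ _ _ _ _ EA) -mulrA; apply: dvdq1M.
  by apply: dvdq1M; apply: dvdq1X; [exact: (dvdq1_int (-1)) | exact: dvdq1_int].
have dZ := rest_term_weighted p y L K A r p_pr p2 y_val K0.
have EM : (p ^ e.+1 = q * p)%N by rewrite expnSr.
have [lt|le] := ltnP (A + s * p) (p ^ e.+1).
  rewrite -[(p ^ _)%N]mul1n; apply: dvdqM; first by apply: dvdq_nat; rewrite dvd1n.
  apply: dvdq_dvd dZ; rewrite dvdn_exp2l // /weight leq_max; apply/orP; right.
  suff: (2 * e.+1 <= A %/ p)%N by move: (A %/ p)%N => d; lia.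
  rewrite leq_divRL //.
  have [u Eu] : exists u, q = (s + u)%N by exists (q - s)%N; rewrite subnKC // ltnW.
  have leNu : (N + r <= u)%N by lia.
  have Eup : (u * (p - 1) + s * p + s * (p - 1) = q * (p - 1) + s * p)%N by rewrite Eu; lia.
  have leu : ((N + r) * (p - 1) <= u * (p - 1))%N by rewrite leq_mul2r leNu orbT.
  have : ((N + r) * (p - 1) + (N + r) = (N + r) * p)%N by rewrite addnC -mulnS subn1 prednK.
  have : (2 * e.+2 * p <= (N + r) * p)%N by rewrite leq_mul2r; apply/orP; right; lia.
  by lia.
have [z Ez dvdz] := bin_shift_ppow p e.+1 (A + s * p - p ^ e.+1) A p_pr.
have lt_sq : (s * p < p ^ e.+1)%N by rewrite EM ltn_mul2r p0.
have ltA : (A + s * p - p ^ e.+1 < A)%N by move: (p ^ e.+1)%N le lt_sq => M; lia.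
rewrite subnK // (bin_small ltA) add0n in Ez.
case: dZ => w ->; rewrite Ez natrM -mulrA; apply: dvdq1M; first exact: dvdq_nat.
rewrite mulrA -natrM -[(p ^ e.+1)%N]muln1; apply: dvdqM; last exact: dvdq1_int.
apply: dvdq_nat; rewrite mulnC (dvdn_trans dvdz) // dvdn_mul // dvdn_exp2l //.
exact: leq_maxl.
Qed.

(** * The congruence and the period *)

(** The first p^e values of s in the longer sum have no partner; the others are
    matched with s - p^e. *)
Lemma scaled_Rsum_shift p y L S e N K : prime p -> (2 < p)%N -> steep_valuations p y ->
  (2 * e.+2 <= N)%N -> (0 < K)%N ->
  dvdq (p ^ e.+1)
    ((p ^ (K %/ p))%:R * Rsum y p L (p ^ e + S) (N + p ^ e * (p - 1)) K
     + (y p./2)%:~R ^+ (p ^ e) * ((p ^ (K %/ p))%:R * Rsum y p L S N K)).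
Proof.
move=> p_pr p2 y_val leN K0; rewrite /Rsum big_split_ord /= mulrDr -addrA; apply: dvdqD.
  rewrite mulr_sumr; apply: dvdq_sum => s _; rewrite mulr_sumr.
  by apply: dvdq_sum => r _; apply: Rterm_low.
rewrite !mulr_sumr -big_split /=; apply: dvdq_sum => s _.
rewrite !mulr_sumr -big_split /=; apply: dvdq_sum => r _.
by rewrite [(p ^ e + s)%N]addnC; apply: Rterm_shift => //; lia.
Qed.

Theorem theorem41 (p : nat) (p_prime : prime p) (p_mod4 : p = 1 %[mod 4])
    (y : nat -> int) (y0 : y 0%N = 1)
    (y_val : forall h : nat, (0 < h)%N ->
       forall n : nat, (uphalf (h * p) <= n)%N -> valuation_ge p (y n) h) :
  (forall n k e : nat, (0 < n)%N -> (0 < k)%N -> (0 < e)%N -> (e + 1 <= n)%N ->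
     rat_eqmod (p ^ e)
       ((p ^ (2 * k %/ p))%:R
          * Rinv y (2 * n + p ^ (e - 1) * (p - 1)) (2 * k))
       ((y ((p - 1) %/ 2)%N)%:~R ^+ (p ^ (e - 1)) * (-1) ^+ ((p - 5) %/ 4)
          * (p ^ (2 * k %/ p))%:R * Rinv y (2 * n) (2 * k)))
  /\
  (quadratic_residue p (y ((p - 1) %/ 2)%N) ->
   coprimez (y ((p - 1) %/ 2)%N) p ->
   forall k e : nat, (0 < k)%N -> (0 < e)%N ->
     purely_periodic_mod (e + 1) (p ^ e) (p ^ (e - 1) * (p - 1) ^ 2 %/ 4)
       (fun n => (p ^ (2 * k %/ p))%:R * Rinv y (2 * n) (2 * k))).
Proof.
have p1 := prime_gt1 p_prime.
have [m [m0 Ep]] : exists m, (0 < m)%N /\ p = (4 * m + 1)%N.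
  exists (p %/ 4)%N; have := divn_eq p 4; rewrite p_mod4 (modn_small (m := 1)) //.
  by move: (p %/ 4)%N => d; lia.
have p2 : (2 < p)%N by lia.
have p_odd : odd p by lia.
have Ehalf : ((p - 1) %/ 2 = p./2)%N by lia.
have Esign : ((p - 5) %/ 4 = m.-1)%N by lia.
rewrite Ehalf Esign; set x := y p./2.
pose q e := (p ^ e)%N.
have q_odd e : odd (q e) by rewrite oddX Ep; lia.
pose lambda e : int := x ^+ q e * (-1) ^+ m.-1.
pose R k n : rat := (p ^ (2 * k %/ p))%:R * Rinv y (2 * n) (2 * k).
have R_int k n : (0 < k)%N -> (0 < n)%N -> dvdq 1 (R k n).
  move=> k0 n0; rewrite /R (@Rinv_even p y (2 * n + p).+1 (2 * n).+1) //; try lia.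
  rewrite mulrCA; apply: dvdq1M; first by rewrite -natrX; apply: dvdq_nat.
  by apply: scaled_Rsum_int; rewrite // ?muln_gt0.
have two_q e : dvdq (p ^ e.+1) (2 ^+ (q e * (2 * m)) - (-1) ^+ m).
  have p_dvd : (p %| 2 ^+ (2 * m) - (-1) ^+ m)%Z.
    by rewrite Ep; apply: two_pow_half; rewrite -Ep.
  have := dvdz_lift p e _ _ p_dvd; rewrite -/(q e) -!exprM ![(_ * q e)%N]mulnC.
  rewrite [(-1) ^+ (_ * _)]exprM -[(-1) ^+ q e]signr_odd q_odd expr1.
  by move/dvdq_int; rewrite rmorphB !rmorphXn rmorphN1.
(* The first claim, with e + 1 for e, and with p - 1 = 4 m. *)
have step k n e : (0 < k)%N -> (e.+2 <= n)%N ->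
    dvdq (p ^ e.+1) (R k (n + q e * (2 * m))%N - (lambda e)%:~R * R k n).
  move=> k0 len; rewrite /R.
  set n' := (n + _)%N.
  have En' : (2 * n' = 2 * n + q e * (p - 1))%N by rewrite /n' Ep; lia.
  pose L := (2 * n' + p).+1.
  have n0 : (0 < n)%N by lia.
  have len' : (n <= n')%N by rewrite leq_addr.
  rewrite (@Rinv_even p y L L _ _ y0 p_odd p1 _ n0 k0); try (rewrite /L; lia).
  rewrite (@Rinv_even p y L (q e + L) n' k) //; try (rewrite /L; lia).
  have dS : dvdq (p ^ e.+1) ((p ^ (2 * k %/ p))%:R * Rsum y p L (q e + L) (2 * n') (2 * k)
    + x%:~R ^+ q e * ((p ^ (2 * k %/ p))%:R * Rsum y p L L (2 * n) (2 * k))).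
    by rewrite En'; apply: scaled_Rsum_shift => //; lia.
  have S_int : dvdq 1 ((p ^ (2 * k %/ p))%:R * Rsum y p L L (2 * n) (2 * k)).
    by apply: scaled_Rsum_int; rewrite // ?muln_gt0.
  set P := (p ^ _)%:R in dS S_int *; set S' := Rsum y p L (q e + L) _ _ in dS *.
  have two_int i : dvdq 1 (2 ^+ i) by apply: dvdq1X; apply: dvdq_nat.
  (* For n < k the exponent n - k is not the true one, but the sum is 0. *)
  have [lekn|ltnk] := leqP k n; last first.
    rewrite (Rsum_eq0 p y L L (2 * n) _ p1) in dS *; last by lia.
    by rewrite !mulr0 ?addr0 ?subr0 mulrCA in dS *; apply: dvdq1M.
  set S := Rsum y p L L _ _ in dS S_int *.
  have -> : (n' - k = (n - k) + q e * (2 * m))%N by rewrite /n' addnBAC.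
  have Esgn : (-1) ^+ m.-1 = - (-1) ^+ m :> rat.
    by rewrite -{2}(prednK m0) exprS mulN1r opprK.
  have -> : P * (2 ^+ (n - k + q e * (2 * m)) * S') - (lambda e)%:~R * (P * (2 ^+ (n - k) * S))
    = 2 ^+ (n - k + q e * (2 * m)) * (P * S' + x%:~R ^+ q e * (P * S))
      - 2 ^+ (n - k) * (x%:~R ^+ q e * ((P * S) * (2 ^+ (q e * (2 * m)) - (-1) ^+ m))).
    by rewrite /lambda rmorphM !rmorphXn rmorphN1 Esgn exprD /=; ring.
  apply: dvdqB; first exact: dvdq1M.
  apply: dvdq1M => //; apply: dvdq1M; last exact: dvdq1M.
  by apply: dvdq1X; apply: dvdq1_int.
split.
  move=> n k [//|e] _ k0 _ len; rewrite subn1 /=.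
  rewrite addn1 in len; have := step k n e k0 len; rewrite /R /lambda.
  rewrite rmorphM /= [(x ^+ _)%:~R]rmorphXn [((-1) ^+ _)%:~R]rmorphXn rmorphN1 /= -/(q e).
  have -> : (2 * n + q e * (p - 1) = 2 * (n + q e * (2 * m)))%N by rewrite Ep; lia.
  by rewrite [_ * (_ * Rinv _ (2 * n) _)]mulrA.
move=> /= [t t_sqr] x_cop k [//|e] k0 _ n len; rewrite subn1 /=.
(* After 2 m steps the index has moved by the claimed period. *)
have iter j : dvdq (p ^ e.+1) (R k (n + j * (q e * (2 * m)))%N - (lambda e)%:~R ^+ j * R k n).
  elim: j => [|j IHj]; first by rewrite addn0 mul1r subrr; apply: dvdq0.
  rewrite mulSn addnCA addnC.
  set n1 := (n + _)%N in IHj *.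
  have -> : R k (n1 + q e * (2 * m))%N - (lambda e)%:~R ^+ j.+1 * R k n =
    (R k (n1 + q e * (2 * m))%N - (lambda e)%:~R * R k n1)
    + (lambda e)%:~R * (R k n1 - (lambda e)%:~R ^+ j * R k n) by rewrite exprS; ring.
  apply: dvdqD; first by apply: step => //; rewrite /n1; lia.
  by apply: dvdq1M => //; apply: dvdq1_int.
have p_dvd : (p %| x ^+ (2 * m) - 1)%Z.
  have charp := pchar_Fp p_prime.
  rewrite (dvdz_pcharf charp) rmorphB rmorphXn /= subr_eq0.
  have Et : x%:~R = t%:~R ^+ 2 :> 'F_p.
    move/eqP: t_sqr; rewrite eqz_mod_dvd (dvdz_pcharf charp) rmorphB rmorphXn /=.
    by rewrite subr_eq0 => /eqP.
  have t0 : t%:~R != 0 :> 'F_p.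
    apply/eqP => t0; move: Et; rewrite t0 expr0n /= => /eqP.
    rewrite -(dvdz_pcharf charp) => dpx; move: x_cop.
    by rewrite /coprimez (gcdz_idPr dpx) /= => /eqP [p_eq1]; rewrite p_eq1 in p1.
  apply/eqP; apply: (mulIf t0); rewrite Et mul1r -exprM -exprSr.
  have -> : ((2 * (2 * m)).+1 = p)%N by rewrite Ep; lia.
  by have := expf_card (t%:~R : 'F_p); rewrite card_Fp.
have lambda1 : dvdq (p ^ e.+1) ((lambda e)%:~R ^+ (2 * m) - 1).
  have := dvdz_lift p e _ _ p_dvd; rewrite expr1n -/(q e) => /dvdq_int.
  rewrite /lambda rmorphB -rmorphXn exprMn -!exprM /=.
  by rewrite [(m.-1 * _)%N]mulnCA [(-1) ^+ _]exprM sqrrN !expr1n mulr1 [(q e * _)%N]mulnC.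
have -> : (p ^ e * (p - 1) ^ 2 %/ 4 = 2 * m * (q e * (2 * m)))%N.
  rewrite (_ : p ^ e * (p - 1) ^ 2 = 2 * m * (q e * (2 * m)) * 4)%N ?mulnK //.
  by rewrite -/(q e) Ep addnK; ring.
rewrite -/(R k n) -/(R k _).
suff: dvdq (p ^ e.+1) ((R k (n + 2 * m * (q e * (2 * m)))%N
    - (lambda e)%:~R ^+ (2 * m) * R k n)
  + R k n * ((lambda e)%:~R ^+ (2 * m) - 1)).
  by rewrite mulrBr mulr1 [R k n * _]mulrC addrA subrK.
by apply: dvdqD => //; apply: dvdq1M => //; apply: R_int => //; lia.
Qed.
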